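(* Let $k\ge2$, let $A_n$ be the connected anti-regular graph with $n=2k$ vertices, and define on $[0,\pi)$ \[f_1(\theta)=\frac{-(\cos\theta+1)+\sqrt{(\cos\theta+1)(\cos\theta+3)}}{2(\cos\theta+1)},\qquad f_2(\theta)=\frac{-(\cos\theta+1)-\sqrt{(\cos\theta+1)(\cos\theta+3)}}{2(\cos\theta+1)},\] and $F(\theta)=\frac{\sin(k\theta)}{\sin(k\theta)+\sin((k-1)\theta)}$, extended by $F(0)=\frac{k}{2k-1}$ and $F(\pi)=k$. Let $\gamma_j=\frac{2\pi j}{2k-1}$ for $j=0,1,\dots,k-1$ (so $F$ has vertical asymptotes at $\gamma_1,\dots,\gamma_{k-1}$ in $(0,\pi)$). (i) The graphs of $F$ and $f_1$ intersect exactly $k$ times in $0<\theta<\pi$. If $\theta^+_1<\dots<\theta^+_k$ are the intersection points, then the positive eigenvalues of $A_n$ are $f_1(\theta^+_1)<f_1(\theta^+_2)<\dots<f_1(\theta^+_k)$, and for $j=1,\dots,k-1$, $f_1(\gamma_{j-1})<f_1(\theta^+_j)<f_1(\gamma_j)$. (ii) The graphs of $F$ and $f_2$ intersect exactly $k-1$ times in $0<\theta<\pi$. If $\theta^-_1<\dots<\theta^-_{k-1}$ are the intersection points, then the negative eigenvalues of $A_n$ other than $-1$ are $f_2(\theta^-_{k-1})<\dots<f_2(\theta^-_2)<f_2(\theta^-_1)<-1$, and for $j=1,\dots,k-1$, $f_2(\gamma_j)<f_2(\theta^-_j)<f_2(\gamma_{j-1})$.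
   Context: A simple graph is anti-regular if exactly two of its vertices have the same degree. For each $n\ge2$, $A_n$ denotes the unique (up to isomorphism) connected anti-regular graph on $n$ vertices; for $n$ even it is the threshold graph with creation sequence $(0,1,0,1,\dots,0,1)$, where a $1$ means the new vertex is joined to all previous vertices and a $0$ means it is added isolated. Eigenvalues are those of the adjacency matrix; $-1$ is an eigenvalue of $A_{2k}$. *)

(* Defs.v *)
From HB Require Import structures.
From mathcomp Require Import all_boot all_order all_algebra.
From mathcomp Require Import all_classical all_reals all_analysis.

Set Implicit Arguments.
Unset Strict Implicit.
Unset Printing Implicit Defensive.

Import Order.TTheory GRing.Theory Num.Theory.
Import numFieldNormedType.Exports.

Local Open Scope classical_set_scope.
Local Open Scope ring_scope.

(* A simple graph on the vertex type T is a symmetric irreflexive e : rel T. *)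

Definition deg (T : finType) (e : rel T) (x : T) : nat := #|[pred y | e x y]|.

Definition connected_graph (T : finType) (e : rel T) : Prop :=
  forall x y, connect e x y.

(* Exactly one unordered pair {x, y} of distinct vertices has equal degrees. *)
Definition antiregular (T : finType) (e : rel T) : Prop :=
  exists x y : T, x <> y /\
    forall u v : T, u <> v ->
      (deg e u = deg e v <-> (u = x /\ v = y) \/ (u = y /\ v = x)).

Definition adjmx (R : realType) (T : finType) (e : rel T) : 'M[R]_#|T| :=
  \matrix_(i, j) (e (enum_val i) (enum_val j))%:R.

Definition f1 (R : realType) (t : R) : R :=
  (- (cos t + 1) + Num.sqrt ((cos t + 1) * (cos t + 3))) / (2 * (cos t + 1)).

Definition f2 (R : realType) (t : R) : R :=
  (- (cos t + 1) - Num.sqrt ((cos t + 1) * (cos t + 3))) / (2 * (cos t + 1)).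

Definition Fden (R : realType) (k : nat) (t : R) : R :=
  sin (k%:R * t) + sin ((k%:R - 1) * t).

(* Where Fden vanishes inside ]0, pi[, the value of F is a junk value. *)
Definition F (R : realType) (k : nat) (t : R) : R :=
  if t == 0 then k%:R / (2 * k%:R - 1)
  else if t == pi then k%:R
  else sin (k%:R * t) / Fden k t.

Definition gamma (R : realType) (k j : nat) : R :=
  2 * pi * j%:R / (2 * k%:R - 1).

Definition vertical_asymptote (R : realType) (f : R -> R) (a : R) : Prop :=
  [\/ f x @[x --> a^'-] --> +oo, f x @[x --> a^'-] --> -oo,
      f x @[x --> a^'+] --> +oo | f x @[x --> a^'+] --> -oo].

(* Abscissae in ]0, pi[ of the common points of the graphs of F and f; the
   condition on Fden says that F is defined at t. *)
Definition intersections (R : realType) (k : nat) (f : R -> R) : set R :=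
  [set t | [/\ 0 < t < pi, Fden k t != 0 & F k t = f t]].

(* A = {x 1 < x 2 < ... < x m}; the other values of x are irrelevant. *)
Definition increasing_enum (R : realType) (m : nat) (x : nat -> R) (A : set R)
    : Prop :=
  (forall i j : nat, (1 <= i)%N -> (i < j)%N -> (j <= m)%N -> x i < x j) /\
  A = [set x j | j in [set j : nat | (1 <= j <= m)%N]].

(* Main.v *)
Require Import Defs.
From HB Require Import structures.
From mathcomp Require Import all_boot all_order all_algebra.
From mathcomp Require Import all_classical all_reals all_analysis.
From mathcomp Require Import zify ring lra.

Set Implicit Arguments.
Unset Strict Implicit.
Unset Printing Implicit Defensive.

Import Order.TTheory GRing.Theory Num.Theory.
Import numFieldNormedType.Exports.

Local Open Scope classical_set_scope.
Local Open Scope ring_scope.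

(* Antiregularity forces the adjacency: u ~ v iff deg u + deg v >= 2k, with
   degrees 1, ..., 2k-1 and only k repeated. A vector depending only on the
   degree is then an eigenvector for x as soon as it satisfies a three-term
   recurrence, solved by (-1)^i sin (i t) when 2 (cos t + 1) x (x + 1) = 1, i.e.
   x = f1 t or x = f2 t; the only remaining equation is F t = x. The twins of
   degree k give the eigenvalue -1.

   With t = 2 phi, the intersection equation becomes the vanishing of a
   continuous function of phi that changes sign between consecutive gamma_j / 2,
   and for f1 also between gamma_(k-1) / 2 and pi / 2; so there are at least k
   points for f1 and k-1 for f2. Since f1 and f2 are
   strictly monotone, this already yields k + (k-1) + 1 = 2k distinct
   eigenvalues; hence there is no other eigenvalue and no other intersection. *)

(** * Structure of antiregular graphs *)

Lemma deg_lt_card (T : finType) (e : rel T) (x : T) :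
  irreflexive e -> (deg e x < #|T|)%N.
Proof.
move=> e_irr; apply: proper_card; apply/properP; split; first exact/fintype.subsetP.
by exists x; rewrite // !inE e_irr.
Qed.

Lemma connected_deg_gt0 (T : finType) (e : rel T) (x : T) :
  connected_graph e -> (1 < #|T|)%N -> (0 < deg e x)%N.
Proof.
move=> e_conn T_gt1; apply/card_gt0P.
have /card_gt0P[y] : (0 < #|predC1 x|)%N.
  by have := cardC1 x; rewrite -ltnS => ->; lia.
rewrite !inE => neq_yx.
have /connectP[[|z p] /=] := e_conn x y.
  by move=> _ E; rewrite E eqxx in neq_yx.
by case/andP=> exz _ _; exists z; rewrite inE.
Qed.

Lemma leq_card_disjoint (T : finType) (A B : {pred T}) :
  (forall w, w \in A -> w \notin B) -> (#|A| + #|B| <= #|T|)%N.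
Proof.
move=> AB; have := subset_leq_card (introT fintype.subsetP AB : A \subset predC B).
by rewrite -(cardC B) addnC leq_add2l.
Qed.

(** Each degree in the range has a witness in [A], and witnesses of distinct degrees are distinct.
    These lower bounds feed the counting arguments below. *)
Lemma card_deg_range (T : finType) (e : rel T) (A : pred T) (a b n : nat) :
  (forall d, (0 < d < n)%N -> exists2 w, A w & deg e w = d) ->
  (0 < a)%N -> (b <= n)%N ->
  (b - a <= #|[pred w | A w & (a <= deg e w < b)%N]|)%N.
Proof.
move=> degS a_gt0 leb.
rewrite -[X in (X <= _)%N](size_iota a) -(size_image (deg e)).
apply: uniq_leq_size (iota_uniq _ _) _ => d; rewrite mem_iota => ltd.
have [|w Aw dw] := degS d; first lia.
by apply/fintype.imageP; exists w => //; rewrite inE Aw dw; lia.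
Qed.

(** Pigeonhole: the [n - 1] vertices other than [x] have distinct degrees among the [n - 1] values
    [1, ..., n - 1]. *)
Lemma deg_surj_off (T : finType) (e : rel T) (x : T) (n : nat) :
  #|T| = n -> (forall u, (0 < deg e u < n)%N) ->
  {in predC1 x &, injective (deg e)} ->
  forall d, (0 < d < n)%N -> exists2 w, w != x & deg e w = d.
Proof.
move=> cardT degB degI d ltd.
have uS : uniq [seq deg e w | w in predC1 x].
  rewrite map_inj_in_uniq ?enum_uniq // => u v; rewrite !mem_enum; exact: degI.
have sS : {subset [seq deg e w | w in predC1 x] <= iota 1 n.-1}.
  by move=> _ /fintype.imageP[w _ ->]; rewrite mem_iota; have := degB w; lia.
have szS : (size (iota 1 n.-1) <= size [seq deg e w | w in predC1 x])%N.
  by rewrite size_iota size_image cardC1 cardT.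
have [_ eqS] := uniq_min_size uS sS szS.
have : d \in iota 1 n.-1 by rewrite mem_iota; lia.
by rewrite -eqS => /fintype.imageP[w wx ->]; exists w.
Qed.

(* Vertices are settled by induction on j, alternating between the degrees
   n - j and j: a vertex of degree n - j misses all vertices of degree below j,
   so it must be adjacent to all the others, and dually. *)
Lemma adjacency_of_degrees (T : finType) (e : rel T) (n : nat) :
  #|T| = n -> symmetric e -> irreflexive e -> (forall u, (0 < deg e u < n)%N) ->
  (forall d, (0 < d < n)%N -> exists2 w, predT w & deg e w = d) ->
  forall u v, e u v = (u != v) && (n <= deg e u + deg e v)%N.
Proof.
move=> cardT e_sym e_irr degB degS.
pose good u := forall v, e u v = (u != v) && (n <= deg e u + deg e v)%N.
suff ind j : (forall u, (n - j <= deg e u)%N -> good u) /\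
             (forall u, (deg e u <= j)%N -> good u).
  by move=> u v; apply: (ind n).1; lia.
elim: j => [|j [IHhi IHlo]].
  by split=> u; have := degB u; lia.
have hi u : (n - j.+1 <= deg e u)%N -> good u.
  move=> du; have [lej|ltj] := leqP (deg e u) j; first exact: IHlo.
  have [|ltnj] := leqP (n - j) (deg e u); first exact: IHhi.
  have jn : (j < n)%N by have := degB u; lia.
  have sub : e u \subset [pred w | (u != w) && (n <= deg e u + deg e w)%N].
    apply/fintype.subsetP=> w; rewrite !unfold_in /= => euw; apply/andP; split.
      by apply: contraTneq euw => ->; rewrite e_irr.
    rewrite leqNgt; apply/negP => lt_n.
    have : e w u by rewrite e_sym.
    by rewrite (IHlo w); lia.
  have card_e : #|e u| = deg e u by apply: eq_card.
  (* Here [deg e u = n - j - 1]. At least [j] vertices have degree in [1, ..., j]; they avoid both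
     [u] and [G], so [G] has at most [n - 1 - j = deg e u] elements and the inclusion [sub] is an
     equality. *)
  have le_card : (#|[pred w | (u != w) && (n <= deg e u + deg e w)%N]| <= #|e u|)%N.
    rewrite card_e; have := card_deg_range degS (leqnn 1) jn.
    set L := [pred w | _ & _]; set G := [pred w | _ & _] => leL.
    have := leq_card_disjoint (A := L) (B := [predU1 u & G]) _.
    rewrite cardU1 !inE eqxx cardT /=.
    have LG w : w \in L -> w \notin [predU1 u & G].
      by rewrite !inE => lw; apply/negP=> /orP[/eqP Ew|]; [subst w|]; lia.
    move=> /(_ LG); move: leL.
    change (j.+1 - 1 <= #|L| -> #|L| + (1 + #|G|) <= n -> #|G| <= deg e u)%N.
    lia.
  have Ee : e u =i [pred w | (u != w) && (n <= deg e u + deg e w)%N].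
    apply: (subset_cardP _ sub); apply/eqP.
    by rewrite eqn_leq le_card subset_leq_card.
  by move=> v; have := Ee v; rewrite !unfold_in.
split=> // u du.
have [lej|ltj] := leqP (deg e u) j; first exact: IHlo.
have [|ltnj] := leqP (n - j.+1) (deg e u); first exact: hi.
have card_e : #|e u| = deg e u by apply: eq_card.
(* Here [deg e u = j + 1]. By [hi] all vertices of degree at least [n - j - 1] are neighbours of
   [u]; there are at least [j + 1] of them, so there are no other neighbours. *)
have sub : [pred w | predT w & (n - j.+1 <= deg e w < n)%N] \subset e u.
  apply/fintype.subsetP=> w; rewrite inE unfold_in /= => dw.
  rewrite e_sym hi; last lia.
  rewrite addnC; apply/andP; split; last lia.
  by apply/negP => /eqP E; subst w; lia.
have Ee : e u =i [pred w | predT w & (n - j.+1 <= deg e w < n)%N].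
  move=> v; apply/esym; apply: (subset_cardP _ sub); apply/eqP.
  rewrite eqn_leq subset_leq_card //= card_e.
  apply: leq_trans (card_deg_range degS _ (leqnn n)); have := degB u; lia.
move=> v; have := Ee v; rewrite !unfold_in /= => ->; have := degB v.
by have [Euv|_] := eqVneq u v => /=; [subst v|]; lia.
Qed.

(** If [deg e x < k], a vertex [v] of degree [2k - 1 - deg e x] misses itself, [x] and at least
    [deg e x] further vertices, too many for its degree. If [deg e x > k], a vertex [v] of degree
    [2k - deg e x] is adjacent to [x] and to at least [2k - deg e x] further vertices, again too
    many. *)
Lemma repeated_degree (T : finType) (e : rel T) (k : nat) (x : T) :
  #|T| = (2 * k)%N -> (forall u, (0 < deg e u < 2 * k)%N) ->
  (forall d, (0 < d < 2 * k)%N -> exists2 w, predC1 x w & deg e w = d) ->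
  (forall u v, e u v = (u != v) && (2 * k <= deg e u + deg e v)%N) ->
  deg e x = k.
Proof.
move=> cardT degB degS adj.
have dx := degB x.
case: (ltngtP (deg e x) k) => // [ltk|gtk].
- have [|v _ dv] := degS (2 * k - 1 - deg e x)%N; first lia.
  have ltx : ((deg e x).+1 <= 2 * k)%N by lia.
  have := card_deg_range degS (leqnn 1) ltx.
  set L := [pred w | _ & _] => leL.
  have := leq_card_disjoint (A := [predU1 x & L]) (B := [predU1 v & e v]) _.
  rewrite !cardU1 !inE eqxx cardT /= unfold_in adj eqxx /=.
  have -> : #|e v| = deg e v by apply: eq_card.
  suff LG w : w \in [predU1 x & L] -> w \notin [predU1 v & e v].
    move=> /(_ LG); move: leL.
    change ((deg e x).+1 - 1 <= #|L| ->
            1 + #|L| + (1 + deg e v) <= 2 * k -> deg e x = k)%N.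
    lia.
  rewrite !inE /= [w \in e v]unfold_in adj dv => dw.
  have {}dw : (deg e w <= deg e x)%N by move: dw => /orP[/eqP->|]; lia.
  by apply/negP => /orP[/eqP E|]; [subst w|]; lia.
- have [|v _ dv] := degS (2 * k - deg e x)%N; first lia.
  have x_gt0 : (0 < deg e x)%N by lia.
  have := card_deg_range degS x_gt0 (leqnn (2 * k)%N).
  set L := [pred w | _ & _] => leL.
  have LT : [predU1 x & L] \subset e v.
    apply/fintype.subsetP=> w; rewrite !inE /= unfold_in adj dv => dw.
    have {}dw : (deg e x <= deg e w)%N by move: dw => /orP[/eqP->|]; lia.
    apply/andP; split; last lia.
    by apply/negP => /eqP E; subst w; lia.
  have := subset_leq_card LT; rewrite cardU1 !inE eqxx /=; move: leL.
  have -> : #|e v| = deg e v by apply: eq_card.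
  change (2 * k - deg e x <= #|L| -> 1 + #|L| <= deg e v -> deg e x = k)%N.
  lia.
Qed.

(** Setting aside one vertex [x] of the pair with equal degrees makes the degree injective on the
    rest, so the rest realises every degree once and [x] repeats one of them, namely [k]. *)
Lemma antiregular_structure (T : finType) (e : rel T) (k : nat) :
  (0 < k)%N -> #|T| = (2 * k)%N -> symmetric e -> irreflexive e ->
  connected_graph e -> antiregular e ->
  [/\ forall u v, e u v = (u != v) && (2 * k <= deg e u + deg e v)%N,
      forall u, (0 < deg e u < 2 * k)%N &
      forall d, (0 < d < 2 * k)%N ->
        #|[pred w | deg e w == d]| = (1 + (d == k))%N].
Proof.
move=> k_gt0 cardT e_sym e_irr e_conn [x [y [neq_xy antiP]]].
have degB u : (0 < deg e u < 2 * k)%N.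
  by rewrite -cardT deg_lt_card // connected_deg_gt0 // cardT; lia.
have degI : {in predC1 x &, injective (deg e)}.
  move=> u v; rewrite !inE => neq_ux neq_vx duv; apply/eqP/negPn/negP => /eqP neq_uv.
  have [+ _] := antiP _ _ neq_uv => /(_ duv)[] [E1 E2];
  by rewrite ?E1 ?E2 eqxx in neq_ux neq_vx.
have degS := deg_surj_off cardT degB degI.
have adj : forall u v, e u v = (u != v) && (2 * k <= deg e u + deg e v)%N.
  apply: adjacency_of_degrees => // d /degS[w _ <-]; by exists w.
have dx := repeated_degree cardT degB degS adj.
split=> // d dB; have [w wx dw] := degS d dB.
case: (eqVneq d k) => [Edk|neq_dk].
- transitivity #|pred2 x w|; last by rewrite card2 eq_sym wx.
  apply: eq_card => u; rewrite !inE; apply/eqP/orP => [du|[]/eqP->]; rewrite ?dx //.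
  have [->|ux] := eqVneq u x; [by left|right].
  by apply/eqP; apply: degI; rewrite ?inE // du.
- transitivity #|pred1 w|; last by rewrite card1.
  apply: eq_card => u; rewrite !inE.
  apply/eqP/eqP => [du|-> //]; apply: degI; rewrite ?inE //; last by rewrite du.
  by apply: contra_neq neq_dk => E; rewrite -du E dx.
Qed.

(** * Eigenvectors *)

(** Lets eigenvectors be functions on the vertices instead of rows indexed by an enumeration. Row
    vectors act on the left, hence the sum over [e w u]. *)
Lemma eigenvalue_adjmx (R : realType) (T : finType) (e : rel T) (x : R)
    (g : T -> R) (u0 : T) :
  g u0 != 0 -> (forall u, \sum_(w | e w u) g w = x * g u) ->
  eigenvalue (adjmx R e) x.
Proof.
move=> gu0 gE; apply/eigenvalueP; exists (\row_j g (enum_val j)).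
  apply/rowP=> j; rewrite !mxE -gE [RHS]big_mkcond /=.
  rewrite [RHS](reindex (@enum_val T T)) /=; last exact/onW_bij/enum_val_bij.
  by apply: eq_bigr => i _; rewrite !mxE; case: ifP; rewrite ?mulr1 ?mulr0.
apply: contraNneq gu0 => /rowP/(_ (enum_rank u0)).
by rewrite !mxE enum_rankK => ->.
Qed.

(** The two vertices of degree [k] are adjacent and have the same closed neighbourhood, so the
    difference of their indicators is an eigenvector. *)
Lemma eigenvalue_twins (R : realType) (T : finType) (e : rel T) (k : nat) :
  (0 < k)%N ->
  (forall u v, e u v = (u != v) && (2 * k <= deg e u + deg e v)%N) ->
  (forall d, (0 < d < 2 * k)%N ->
     #|[pred w | deg e w == d]| = (1 + (d == k))%N) ->
  eigenvalue (adjmx R e) (-1).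
Proof.
move=> k_gt0 adj mult.
have /card_gt1P[a [b [+ + neq_ab]]] : (1 < #|[pred w | deg e w == k]|)%N.
  by rewrite mult ?eqxx //; lia.
rewrite !inE => /eqP da /eqP db.
pose g w : R := (w == a)%:R - (w == b)%:R.
apply: (@eigenvalue_adjmx _ _ _ _ g a).
  by rewrite /g eqxx (negbTE neq_ab) subr0 oner_eq0.
move=> u; rewrite big_mkcond /= (bigD1 a) //= (bigD1 b) 1?eq_sym //= big1 ?addr0.
  rewrite /g !adj da db !eqxx (negbTE neq_ab) [b == a]eq_sym (negbTE neq_ab) /=.
  case: (eqVneq a u) => [<-|neq_ua].
    rewrite da (negbTE neq_ab) [b == a]eq_sym (negbTE neq_ab).
    by rewrite addnn -mul2n leqnn /=; lra.
  case: (eqVneq b u) => [<-|neq_ub] /=.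
    by rewrite db addnn -mul2n leqnn /=; lra.
  by case: ifP => _; lra.
by move=> w /andP[/negbTE wa /negbTE wb]; rewrite /g wa wb subrr if_same.
Qed.

(* By threshold adjacency, the sums of the eigenvector over
   [{w | 2k <= d + deg w}] satisfy a first-order recurrence in [d]; the
   three-term recurrence for [p] solves it for [d <> k], and the last
   hypothesis is what remains of it at the doubled degree [d = k]. *)
Lemma eigenvalue_recurrence (R : realType) (T : finType) (e : rel T) (k : nat)
    (p : nat -> R) (c x : R) :
  (1 < k)%N ->
  (forall u v, e u v = (u != v) && (2 * k <= deg e u + deg e v)%N) ->
  (forall u, (0 < deg e u < 2 * k)%N) ->
  (forall d, (0 < d < 2 * k)%N ->
     #|[pred w | deg e w == d]| = (1 + (d == k))%N) ->
  p 0%N = 0 -> p 1%N != 0 ->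
  (forall i, p i.+2 = - (2 * c) * p i.+1 - p i) ->
  2 * (c + 1) * (x * (x + 1)) = 1 ->
  x * (p k - p k.-1) = p k ->
  eigenvalue (adjmx R e) x.
Proof.
move=> k_gt1 adj degB mult p0 p1 pS xc pk.
(* Subtracting the eigenvalue equations at degrees [i - 1] and [i], both below [k], forces the value
   [q i] at degree [2k - i]; this dictates [a]. *)
pose q i := x * (p i - p i.-1).
pose a d := if (d < k)%N then p d else q (2 * k - d)%N.
have [u0 du0] : exists u0, deg e u0 = 1%N.
  have /card_gt0P[u] : (0 < #|[pred w | deg e w == 1%N]|)%N by rewrite mult; lia.
  by rewrite inE => /eqP; exists u.
apply: (@eigenvalue_adjmx _ _ _ _ (a \o deg e) u0); first by rewrite /= du0 /a k_gt1.
pose S d := \sum_(w | (2 * k <= d + deg e w)%N) a (deg e w).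
have S_rec d : (d.+1 < 2 * k)%N ->
    S d.+1 = S d + a (2 * k - d.+1)%N *+ (1 + (d.+1 == k)).
  move=> ltd; rewrite /S (bigID (fun w => 2 * k <= d + deg e w)%N) /=; congr (_ + _).
    by apply: eq_bigl => w; lia.
  have -> : (d.+1 == k) = (2 * k - d.+1 == k)%N by lia.
  rewrite -mult; last lia.
  rewrite -sumr_const; apply: eq_big => [w|w lew]; rewrite ?inE; first lia.
  by congr (a _); lia.
(* When [k <= d], a vertex of degree [d] satisfies the condition defining [S d] without being its
   own neighbour; this accounts for the extra term. *)
have SE d : (d < 2 * k)%N -> S d = (x + (k <= d)%:R) * a d.
  elim: d => [|d IHd] ltd.
    rewrite /S big_pred0 => [|w]; last by have := degB w; lia.
    by rewrite /a (ltnW k_gt1) p0 mulr0.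
  rewrite S_rec // IHd; last lia.
  rewrite /a; case: (ltngtP d.+1 k) => [ltk|gtk|eqk].
  - rewrite [(2 * k - d.+1 < k)%N]ltnNge [(k <= d)%N]leqNgt.
    have -> : (k <= 2 * k - d.+1)%N by lia.
    have -> : (2 * k - (2 * k - d.+1) = d.+1)%N by lia.
    by rewrite (ltnW ltk) /q /= addr0 mulr1n; ring.
    (* Beyond [k] the claim says that [x (x + 1)] times the second difference of [p] at [2k - d - 1]
       is minus the value of [p] there; by the recurrence that difference is [- 2 (c + 1)] times
       this value. *)
    have -> : (2 * k - d.+1 < k)%N by lia.
    have -> : (k <= d)%N by lia.
    case Ei: (2 * k - d.+1)%N => [|i]; first lia.
    have -> : (2 * k - d = i.+2)%N by lia.
    have E : p i.+1 = 2 * (c + 1) * (x * (x + 1)) * p i.+1 by rewrite xc mul1r.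
    by rewrite /q /= pS mulr1n addn0 /= mulr1n [X in _ + X = _]E; ring.
    have -> : (k <= d)%N = false by lia.
    have -> : (2 * k - d.+1 = k)%N by lia.
    rewrite ltnn /q; have -> : (2 * k - k = k)%N by lia.
    have -> : p d = p k.-1 by rewrite -eqk.
    have E : x * p k.-1 = x * p k - p k by rewrite -[X in _ - X]pk; ring.
    by rewrite pk /= addr0 E; ring.
move=> u /=; have := SE _ (andP (degB u)).2; rewrite mulrDl => SEu.
have -> : x * a (deg e u) = S (deg e u) - (k <= deg e u)%:R * a (deg e u).
  by rewrite SEu addrK.
apply/eqP; rewrite eq_sym subr_eq; apply/eqP; rewrite /S.
have [lek|gtk] := leqP k (deg e u).
  rewrite (bigD1 u) /=; last lia.
  rewrite addrC mul1r; congr (_ + _); apply: eq_bigl => w.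
  by rewrite adj eq_sym andbC addnC.
rewrite /= mul0r addr0; apply: eq_bigl => w.
by rewrite adj; case: (eqVneq u w) => [<-|_] /=; lia.
Qed.

(** * Intersection points *)

Lemma cosD1_gt0 (R : realType) (t : R) : 0 <= t < pi -> 0 < cos t + 1.
Proof.
move=> /andP[t_ge0 t_ltpi]; rewrite -[1]opprK -cospi subr_gt0.
by rewrite ltr_cos // in_itv /= ?t_ge0 ?pi_ge0 ?lexx // ltW.
Qed.

(** Once [cos t + 1] is factored out, [f1] and [f2] depend on [t] only through
    [1 + 2 / (cos t + 1)], which exceeds 1 and increases with [t]; signs and monotonicity follow. *)
Lemma sqrt_cos_factor (R : realType) (t : R) : 0 <= t < pi ->
  Num.sqrt ((cos t + 1) * (cos t + 3)) =
  (cos t + 1) * Num.sqrt (1 + 2 / (cos t + 1)).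
Proof.
move=> /cosD1_gt0 c_gt0; have c_neq0 := lt0r_neq0 c_gt0.
have -> : (cos t + 1) * (cos t + 3) = (cos t + 1) ^+ 2 * (1 + 2 / (cos t + 1)).
  by field.
by rewrite sqrtrM ?sqr_ge0 // sqrtr_sqr gtr0_norm.
Qed.

Lemma f1E (R : realType) (t : R) : 0 <= t < pi ->
  f1 t = (Num.sqrt (1 + 2 / (cos t + 1)) - 1) / 2.
Proof.
move=> tB; rewrite /f1 sqrt_cos_factor //.
have c_neq0 := lt0r_neq0 (cosD1_gt0 tB); by field.
Qed.

Lemma f2E (R : realType) (t : R) : 0 <= t < pi ->
  f2 t = (- Num.sqrt (1 + 2 / (cos t + 1)) - 1) / 2.
Proof.
move=> tB; rewrite /f2 sqrt_cos_factor //.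
have c_neq0 := lt0r_neq0 (cosD1_gt0 tB); by field.
Qed.

Lemma ltr_sqrt_cos (R : realType) (t u : R) : 0 <= t -> t < u -> u < pi ->
  Num.sqrt (1 + 2 / (cos t + 1)) < Num.sqrt (1 + 2 / (cos u + 1)).
Proof.
move=> t_ge0 ltu u_lt.
have ct : 0 < cos t + 1 by apply: cosD1_gt0; lra.
have cu : 0 < cos u + 1 by apply: cosD1_gt0; lra.
rewrite ltr_sqrt; last by rewrite addr_gt0 // divr_gt0.
rewrite ltrD2l ltr_pM2l // ltf_pV2 ?posrE // ltrD2r.
by rewrite ltr_cos // in_itv /=; lra.
Qed.

Lemma ltr_f1 (R : realType) (t u : R) : 0 <= t -> t < u -> u < pi -> f1 t < f1 u.
Proof.
by move=> t0 tu u1; have := ltr_sqrt_cos t0 tu u1; rewrite !f1E; lra.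
Qed.

Lemma ltr_f2 (R : realType) (t u : R) : 0 <= t -> t < u -> u < pi -> f2 u < f2 t.
Proof.
by move=> t0 tu u1; have := ltr_sqrt_cos t0 tu u1; rewrite !f2E; lra.
Qed.

Lemma sqrt_cos_gt1 (R : realType) (t : R) : 0 <= t < pi ->
  1 < Num.sqrt (1 + 2 / (cos t + 1)).
Proof.
move=> tB; have c_gt0 := cosD1_gt0 tB.
have lt1 : 1 < 1 + 2 / (cos t + 1) by rewrite ltrDl divr_gt0.
by rewrite -[X in X < _]sqrtr1 ltr_sqrt // (lt_trans ltr01).
Qed.

Lemma f1_gt0 (R : realType) (t : R) : 0 <= t < pi -> 0 < f1 t.
Proof. by move=> tB; have := sqrt_cos_gt1 tB; rewrite f1E //; lra. Qed.

Lemma f2_ltN1 (R : realType) (t : R) : 0 <= t < pi -> f2 t < -1.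
Proof. by move=> tB; have := sqrt_cos_gt1 tB; rewrite f2E //; lra. Qed.

Lemma sqr_sqrt_cos (R : realType) (t : R) : 0 <= t < pi ->
  (cos t + 1) * Num.sqrt (1 + 2 / (cos t + 1)) ^+ 2 = cos t + 3.
Proof.
move=> tB; have c_gt0 := cosD1_gt0 tB; have c_neq0 := lt0r_neq0 c_gt0.
by rewrite sqr_sqrtr ?addr_ge0 ?divr_ge0 ?ltW //; field.
Qed.

Lemma f1_quadratic (R : realType) (t : R) : 0 <= t < pi ->
  2 * (cos t + 1) * (f1 t * (f1 t + 1)) = 1.
Proof.
by move=> tB; rewrite f1E //; have := sqr_sqrt_cos tB; set r := Num.sqrt _; lra.
Qed.

Lemma f2_quadratic (R : realType) (t : R) : 0 <= t < pi ->
  2 * (cos t + 1) * (f2 t * (f2 t + 1)) = 1.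
Proof.
by move=> tB; rewrite f2E //; have := sqr_sqrt_cos tB; set r := Num.sqrt _; lra.
Qed.

(** Sum-to-product. On []0, pi/2[] the cosine has no zero, so the poles of [F] come from the sine
    factor alone. *)
Lemma Fden_half (R : realType) (k : nat) (x : R) :
  Fden k (2 * x) = 2 * sin ((2 * k%:R - 1) * x) * cos x.
Proof.
rewrite /Fden.
have -> : k%:R * (2 * x) = (2 * k%:R - 1) * x + x by ring.
have -> : (k%:R - 1) * (2 * x) = (2 * k%:R - 1) * x - x by ring.
by rewrite sinD sinB; ring.
Qed.

Lemma FE (R : realType) (k : nat) (t : R) : 0 < t < pi ->
  F k t = sin (k%:R * t) / Fden k t.
Proof.
by case/andP=> t_gt0 t_lt; rewrite /F (gt_eqF t_gt0) (lt_eqF t_lt).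
Qed.

Lemma sin_natpi (R : realType) (j : nat) (x : R) :
  sin (x + pi * j%:R) = (- 1) ^+ j * sin x.
Proof. by rewrite mulr_natr (alternatingn (@sinDpi R)). Qed.

Lemma cos_natpi (R : realType) (j : nat) (x : R) :
  cos (x + pi * j%:R) = (- 1) ^+ j * cos x.
Proof. by rewrite mulr_natr (alternatingn (@cosDpi R)). Qed.

(** With [j] the integer part of [x / pi], the remainder [x - pi j] lies in [[0, pi[] and its sine
    vanishes, so it is 0. *)
Lemma sin_eq0_pi (R : realType) (x : R) : 0 < x -> sin x = 0 ->
  exists2 j : nat, (0 < j)%N & x = pi * j%:R.
Proof.
move=> x_gt0 sx; have p_gt0 := pi_gt0 R.
have xp_ge0 : 0 <= x / pi by rewrite divr_ge0 // ltW.
have /andP[] := truncn_itv xp_ge0.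
set j := Num.truncn _; rewrite ler_pdivlMr // ltr_pdivrMr // => lej ltj.
have Ex : x = pi * j%:R.
  apply/eqP; rewrite eq_sym -subr_eq0 -oppr_eq0 opprB; apply/eqP.
  have r_ge0 : 0 <= x - pi * j%:R by rewrite mulrC subr_ge0.
  move: r_ge0; rewrite le_eqVlt => /predU1P[<- //|r_gt0].
  have : 0 < sin (x - pi * j%:R).
    apply: sin_gt0_pi; rewrite r_gt0 /= ltrBlDl.
    by move: ltj; rewrite -natr1 mulrDl mul1r mulrC.
  have := sin_natpi j (x - pi * j%:R); rewrite subrK sx => /esym/eqP.
  by rewrite mulf_eq0 signr_eq0 /= => /eqP ->; rewrite ltxx.
exists j => //; rewrite lt0n; apply/eqP => j0.
by move: x_gt0; rewrite Ex j0 mulr0 ltxx.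
Qed.

(** The product form suits end values whose signs alternate with an index. The root is interior
    since [f] vanishes at neither end. *)
Lemma IVT_sign (R : realType) (f : R -> R) (a b : R) :
  a < b -> continuous f -> f a * f b < 0 -> exists2 c, a < c < b & f c = 0.
Proof.
move=> ltab f_cont fab.
have [|c] := IVT (v := 0) (ltW ltab) (continuous_subspaceT f_cont).
  by rewrite ge_min le_max; have [|] := ltP (f a) 0; have [|] := ltP (f b) 0; nra.
rewrite in_itv /= => /andP[ac cb] fc; exists c => //.
rewrite !lt_neqAle ac cb !andbT; apply/andP; split.
  by apply: contraTneq fab => ->; rewrite fc mul0r ltxx.
by apply: contraTneq fab => <-; rewrite fc mulr0 ltxx.
Qed.

(* [F k (2 * x)] minus [f1 (2 * x)] (for [s = 1]) or [f2 (2 * x)] (for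
   [s = -1]), times [Fden k (2 * x)]: the factor removes the poles of [F]. *)
Definition gap (R : realType) (k : nat) (s x : R) : R :=
  cos ((2 * k%:R - 1) * x) * sin x +
  sin ((2 * k%:R - 1) * x) * (2 * cos x - s * Num.sqrt (1 + cos x ^+ 2)).

Lemma gap_continuous (R : realType) (k : nat) (s : R) : continuous (gap k s).
Proof.
move=> x; rewrite /gap.
have cont (f g : R -> R) : continuous g -> continuous f -> continuous (g \o f).
  by move=> g_cont f_cont y; apply: continuous_comp; [exact: f_cont|exact: g_cont].
have Mx : continuous (fun y : R => (2 * k%:R - 1) * y) by exact: mulrl_continuous.
have cosx := @continuous_cos R; have sinx := @continuous_sin R.
apply: cvgD; apply: cvgM; try exact: sinx; try exact: cont.
apply: cvgB; apply: cvgM; try exact: cvg_cst; first exact: cosx.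
apply: (cont (fun y => 1 + cos y ^+ 2) Num.sqrt); first exact: sqrt_continuous.
by move=> y; apply: cvgD; [exact: cvg_cst|apply: cvgM; exact: cosx].
Qed.

(** As [cos (2 x) + 1 = 2 cos x ^ 2], the radical becomes [sqrt (1 + cos x ^ 2) / cos x]. Clearing
    denominators adds no root: at a pole of [F] the gap equals [sin x] up to sign. *)
Lemma gap_root (R : realType) (k : nat) (s x : R) :
  0 < x < pi / 2 -> gap k s x = 0 ->
  Fden k (2 * x) != 0 /\
  F k (2 * x) = (s * Num.sqrt (1 + 2 / (cos (2 * x) + 1)) - 1) / 2.
Proof.
move=> /andP[x_gt0 x_lt] gap0.
have p_gt0 := pi_gt0 R.
have c_gt0 : 0 < cos x by apply: cos_gt0_pihalf; lra.
have c_neq0 := lt0r_neq0 c_gt0.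
have s_gt0 : 0 < sin x by apply: sin_gt0_pi; lra.
have -> : Num.sqrt (1 + 2 / (cos (2 * x) + 1)) = Num.sqrt (1 + cos x ^+ 2) / cos x.
  have -> : 1 + 2 / (cos (2 * x) + 1) = (1 + cos x ^+ 2) * (cos x)^-1 ^+ 2.
    by rewrite [2 * x]mulr_natl cos_mulr2n subrK mulr2n; field.
  by rewrite sqrtrM ?addr_ge0 ?sqr_ge0 // sqrtr_sqr gtr0_norm ?invr_gt0.
have S_neq0 : sin ((2 * k%:R - 1) * x) != 0.
  apply/eqP => S0; have := sin0cos1 S0 => C1; move: gap0.
  rewrite /gap S0 mul0r addr0 => /eqP; rewrite mulf_eq0 (gt_eqF s_gt0) orbF.
  by rewrite -normr_eq0 C1 oner_eq0.
have tB : 0 < 2 * x < pi by lra.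
rewrite FE // Fden_half; split; first by rewrite !mulf_neq0.
have -> : k%:R * (2 * x) = (2 * k%:R - 1) * x + x by ring.
rewrite sinD; move: gap0; rewrite /gap.
set S := sin (_ * x); set C := cos (_ * x); set q := Num.sqrt _ => gap0.
have -> : C * sin x = S * (s * q - 2 * cos x).
  by apply/eqP; rewrite -subr_eq0 -[X in _ == X]gap0; apply/eqP; ring.
by field; rewrite c_neq0.
Qed.

(** At the half of [gamma R k j] the term containing [s] drops out, so the sign alternates with [j]
    in the same way for [f1] and [f2]. *)
Lemma gap_natpi (R : realType) (k j : nat) (s : R) : (0 < k)%N ->
  gap k s (pi * j%:R / (2 * k%:R - 1)) =
  (-1) ^+ j * sin (pi * j%:R / (2 * k%:R - 1)).
Proof.
move=> k_gt0; have k_ge1 : 1 <= k%:R :> R by rewrite ler1n.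
have M_neq0 : 2 * k%:R - 1 != 0 :> R by apply: lt0r_neq0; lra.
rewrite /gap.
have -> : (2 * k%:R - 1) * (pi * j%:R / (2 * k%:R - 1)) = 0 + pi * j%:R :> R by field.
by rewrite sin_natpi cos_natpi sin0 cos0; ring.
Qed.

(** Gives the sign of the gap at [pi / (2 (2k - 1))], which is at most [pi / 6] as [k >= 2]. It
    suffices that [cos x ^ 2 >= 1/2], which is [cos (2 x) >= 0]. *)
Lemma sqrt_cos_lt2 (R : realType) (x : R) : 0 <= x <= pi / 6 ->
  Num.sqrt (1 + cos x ^+ 2) < 2 * cos x.
Proof.
move=> xB; have p_gt0 := pi_gt0 R.
have c_gt0 : 0 < cos x by apply: cos_gt0_pihalf; lra.
suff : 1 < 3 * cos x ^+ 2.
  move=> c2; rewrite -[X in _ < X]gtr0_norm ?mulr_gt0 // -sqrtr_sqr.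
  by rewrite ltr_sqrt; nra.
have : 0 <= cos (2 * x) by apply: cos_ge0_pihalf; lra.
by rewrite [2 * x]mulr_natl cos_mulr2n; lra.
Qed.

(* At the ends of the interval the gap has signs [(-1)^(j-1)] and [(-1)^j];
   for [j = 1] it vanishes at the left end, which is replaced by
   [pi / (2 (2k-1))]. *)
Lemma gap_root_exists (R : realType) (k j : nat) (s : R) :
  (1 < k)%N -> s <= 1 -> (0 < j < k)%N ->
  exists2 x, pi * j.-1%:R / (2 * k%:R - 1) < x < pi * j%:R / (2 * k%:R - 1)
    & gap k s x = 0.
Proof.
move=> k_gt1 s_le1 /andP[j_gt0 ltjk]; have p_gt0 := pi_gt0 R.
have k_ge2 : 2 <= k%:R :> R by rewrite ler_nat.
have M_gt0 : 0 < 2 * k%:R - 1 :> R by lra.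
have sin_gt0 i : (0 < i < k)%N -> 0 < sin (pi * i%:R / (2 * k%:R - 1) : R).
  move=> /andP[i_gt0 ltik]; apply: sin_gt0_pi; rewrite divr_gt0 ?mulr_gt0 ?ltr0n //=.
  rewrite ltr_pdivrMr // ltr_pM2l //.
  have : i%:R < k%:R :> R by rewrite ltr_nat.
  lra.
case: j j_gt0 ltjk => // -[|j] _ ltjk /=.
  have [|||x xB gx] := @IVT_sign R (gap k s)
    (pi / 2 / (2 * k%:R - 1)) (pi * 1%:R / (2 * k%:R - 1)).
  - by rewrite ltr_pM2r ?invr_gt0 //; lra.
  - exact: gap_continuous.
  - have s1 := sin_gt0 1%N ltjk.
    rewrite gap_natpi ?(ltn_trans _ k_gt1) // expr1 mulN1r mulrN oppr_lt0.
    rewrite pmulr_lgt0 // /gap.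
    (* At this left end only the second term of the gap survives, with sine factor 1; it is positive
       because [s <= 1]. *)
    have -> : (2 * k%:R - 1) * (pi / 2 / (2 * k%:R - 1)) = pi / 2 :> R.
      by field; rewrite lt0r_neq0.
    rewrite cos_pihalf sin_pihalf mul0r add0r mul1r subr_gt0.
    apply: le_lt_trans (sqrt_cos_lt2 _).
      by rewrite ler_piMl ?sqrtr_ge0.
    apply/andP; split; first by rewrite ltW // !divr_gt0.
    by rewrite ler_pdivrMr //; nra.
  exists x => //; rewrite mulr0 mul0r; case/andP: xB => xl ->; rewrite andbT.
  by apply: lt_trans xl; rewrite !divr_gt0.
have [|||x xB gx] := @IVT_sign R (gap k s)
  (pi * j.+1%:R / (2 * k%:R - 1)) (pi * j.+2%:R / (2 * k%:R - 1)).
- by rewrite ltr_pM2r ?invr_gt0 // ltr_pM2l // ltr_nat.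
- exact: gap_continuous.
- rewrite !gap_natpi ?(ltn_trans _ k_gt1) // mulrACA -exprD -signr_odd oddD.
  rewrite (_ : odd j.+1 (+) odd j.+2 = true) /=; last by case: odd.
  by rewrite expr1 mulN1r oppr_lt0 mulr_gt0 // sin_gt0 //; lia.
by exists x.
Qed.

(** At [pi / 2] the gap is [- s (-1)^(k-1)]. For [s = 1] its sign is opposite to the one at the left
    end; for [s = -1] the two agree, which is why [f2] gets one point fewer. *)
Lemma gap1_root_last (R : realType) (k : nat) : (1 < k)%N ->
  exists2 x : R, pi * k.-1%:R / (2 * k%:R - 1) < x < pi / 2 & gap k 1 x = 0.
Proof.
move=> k_gt1; have p_gt0 := pi_gt0 R.
have k_ge2 : 2 <= k%:R :> R by rewrite ler_nat.
have kE : k%:R = k.-1%:R + 1 :> R by rewrite natr1 prednK // ltnW.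
have M_gt0 : 0 < 2 * k%:R - 1 :> R by lra.
have ltab : pi * k.-1%:R / (2 * k%:R - 1) < pi / 2 :> R.
  by rewrite ltr_pdivrMr // kE; lra.
have [||x xB gx] := @IVT_sign R (gap k 1) _ _ ltab; last by exists x.
- exact: gap_continuous.
- rewrite gap_natpi ?(ltn_trans _ k_gt1) // /gap.
  have -> : (2 * k%:R - 1) * (pi / 2) = pi / 2 + pi * k.-1%:R :> R by rewrite kE; field.
  rewrite sin_natpi cos_natpi cos_pihalf sin_pihalf expr0n addr0 sqrtr1.
  have : 0 < sin (pi * k.-1%:R / (2 * k%:R - 1) : R).
    apply: sin_gt0_pi; rewrite (lt_trans ltab) ?andbT; last lra.
    by rewrite divr_gt0 ?mulr_gt0 // ltr0n -ltnS prednK // ltnW.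
  have : (-1) ^+ k.-1 * (-1) ^+ k.-1 = 1 :> R.
    by rewrite -exprD addnn -signr_odd odd_double.
  set e := (-1) ^+ _; nra.
Qed.

Lemma gammaE (R : realType) (k j : nat) :
  gamma R k j = 2 * (pi * j%:R / (2 * k%:R - 1)).
Proof. by rewrite /gamma !mulrA. Qed.

Lemma gamma_pred_lt_pi (R : realType) (k : nat) : (1 < k)%N -> gamma R k k.-1 < pi.
Proof.
move=> k_gt1; rewrite gammaE.
have kE : k%:R = k.-1%:R + 1 :> R by rewrite natr1 prednK // ltnW.
have k_ge2 : 2 <= k%:R :> R by rewrite ler_nat.
have p_gt0 := pi_gt0 R.
have M_gt0 : 0 < 2 * k%:R - 1 :> R by lra.
by rewrite mulrA ltr_pdivrMr // kE; lra.
Qed.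

Lemma ltr_gamma (R : realType) (k i j : nat) : (0 < k)%N ->
  (gamma R k i < gamma R k j) = (i < j)%N.
Proof.
move=> k_gt0; have k_ge1 : 1 <= k%:R :> R by rewrite ler1n.
by rewrite ltr_pM2r ?invr_gt0; [rewrite ltr_pM2l ?mulr_gt0 ?pi_gt0 // ltr_nat|lra].
Qed.

Lemma gap_root_f1 (R : realType) (k : nat) (x : R) :
  0 < x < pi / 2 -> gap k 1 x = 0 -> intersections k (@f1 R) (2 * x).
Proof.
move=> xB gx; have [Fx FxE] := gap_root xB gx; split => //; first lra.
by rewrite FxE mul1r f1E //; lra.
Qed.

Lemma gap_root_f2 (R : realType) (k : nat) (x : R) :
  0 < x < pi / 2 -> gap k (-1) x = 0 -> intersections k (@f2 R) (2 * x).
Proof.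
move=> xB gx; have [Fx FxE] := gap_root xB gx; split => //; first lra.
by rewrite FxE mulN1r f2E //; lra.
Qed.

Lemma half_bound (R : realType) (k j : nat) (x : R) : (1 < k)%N -> (0 < j < k)%N ->
  pi * j.-1%:R / (2 * k%:R - 1) < x < pi * j%:R / (2 * k%:R - 1) -> 0 < x < pi / 2.
Proof.
move=> k_gt1 jB /andP[xl xr]; have p_gt0 := pi_gt0 R.
have k_ge2 : 2 <= k%:R :> R by rewrite ler_nat.
rewrite (le_lt_trans _ xl) /=; last by rewrite !mulr_ge0 ?invr_ge0 ?ler0n ?pi_ge0 //; lra.
have := gamma_pred_lt_pi R k_gt1.
have : gamma R k j <= gamma R k k.-1 by rewrite leNgt ltr_gamma; lia.
by rewrite !gammaE; lra.
Qed.

Lemma f1_intersection_exists (R : realType) (k j : nat) :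
  (1 < k)%N -> (0 < j <= k)%N ->
  exists2 t : R, intersections k (@f1 R) t & gamma R k j.-1 < t < gamma R k j.
Proof.
move=> k_gt1 /andP[j_gt0]; rewrite leq_eqVlt => /predU1P[->|ltjk].
  have [x xB gx] := gap1_root_last R k_gt1; have p_gt0 := pi_gt0 R.
  have k_ge2 : 2 <= k%:R :> R by rewrite ler_nat.
  exists (2 * x); first apply: gap_root_f1 => //.
    case/andP: xB => xl ->; rewrite andbT; apply: le_lt_trans xl.
    by rewrite !mulr_ge0 ?invr_ge0 ?ler0n ?pi_ge0 //; lra.
  have M_gt0 : 0 < 2 * k%:R - 1 :> R by lra.
  (* The last point lies below [pi], hence below [gamma R k k], and the case [j = k] takes the same
     form as the others. *)
  have : pi < gamma R k k by rewrite gammaE mulrA ltr_pdivlMr //; lra.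
  by rewrite !gammaE; lra.
have jB : (0 < j < k)%N by rewrite j_gt0.
have [x xB gx] := gap_root_exists k_gt1 (lexx (1 : R)) jB.
exists (2 * x); last by rewrite !gammaE; lra.
exact: gap_root_f1 (half_bound k_gt1 jB xB) gx.
Qed.

Lemma f2_intersection_exists (R : realType) (k j : nat) :
  (1 < k)%N -> (0 < j < k)%N ->
  exists2 t : R, intersections k (@f2 R) t & gamma R k j.-1 < t < gamma R k j.
Proof.
move=> k_gt1 jB.
have [|x xB gx] := gap_root_exists (s := -1 : R) k_gt1 _ jB; first lra.
exists (2 * x); last by rewrite !gammaE; lra.
exact: gap_root_f2 (half_bound k_gt1 jB xB) gx.
Qed.

(** * Asymptotes *)

Lemma cvg_fin_not_pinfty (R : realType) (T : Type) (a : set_system T)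
    (f : T -> R) (l : R) : ProperFilter a -> f @ a --> l -> ~ (f @ a --> +oo).
Proof.
move=> aF /cvgr_lt/(_ (l + 1)) fl /cvgryPgt/(_ (l + 1)) fo.
have : \forall x \near a, False.
  near=> x; have : f x < l + 1 by near: x; apply: fl; rewrite ltrDl.
  by apply/negP; rewrite -leNgt ltW //; near: x.
by move/filter_ex => [].
Unshelve. all: by end_near. Qed.

Lemma cvg_fin_not_ninfty (R : realType) (T : Type) (a : set_system T)
    (f : T -> R) (l : R) : ProperFilter a -> f @ a --> l -> ~ (f @ a --> -oo).
Proof.
move=> aF /cvgN fl /cvgNry fo; exact: cvg_fin_not_pinfty fl fo.
Qed.

Lemma sin_mul_continuous (R : realType) (c : R) :
  continuous (fun x : R => sin (c * x)).
Proof.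
move=> x; apply: (continuous_comp (f := fun x : R => c * x)).
  exact: mulrl_continuous.
exact: continuous_sin.
Qed.

Lemma Fden_continuous (R : realType) (k : nat) : continuous (@Fden R k).
Proof. by move=> x; apply: cvgD; apply: sin_mul_continuous. Qed.

Lemma near_FE (R : realType) (k : nat) (t : R) : 0 < t < pi ->
  \forall x \near t, F k x = sin (k%:R * x) / Fden k x.
Proof.
move=> /andP[t_gt0 t_lt]; near=> x; rewrite FE //; apply/andP; split.
  by near: x; exact: lt_nbhsr.
by near: x; exact: lt_nbhsl.
Unshelve. all: by end_near. Qed.

Lemma F_cvg (R : realType) (k : nat) (t : R) : 0 < t < pi -> Fden k t != 0 ->
  F k x @[x --> t] --> sin (k%:R * t) / Fden k t.
Proof.
move=> tB Ft.
have nF : {near t, (fun x : R => sin (k%:R * x) / Fden k x) =1 F k}.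
  by apply: filterS (near_FE k tB) => x ->.
apply: cvg_trans (near_eq_cvg nF) _.
by apply: cvgM; [exact: sin_mul_continuous|apply: cvgV => //; exact: Fden_continuous].
Qed.

(** Where [Fden] does not vanish, [F] has a finite limit, which excludes all four kinds of
    divergence. *)
Lemma vertical_asymptote_Fden0 (R : realType) (k : nat) (t : R) :
  0 < t < pi -> vertical_asymptote (F k) t -> Fden k t = 0.
Proof.
move=> tB va; apply/eqP/negPn/negP => Ft; have cF := F_cvg tB Ft.
have cl := cvg_at_left_filter cF; have cr := cvg_at_right_filter cF.
case: va; [exact: cvg_fin_not_pinfty cl|exact: cvg_fin_not_ninfty cl|
           exact: cvg_fin_not_pinfty cr|exact: cvg_fin_not_ninfty cr].
Qed.

Lemma Fden0_gamma (R : realType) (k : nat) (t : R) : (0 < k)%N ->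
  0 < t < pi -> Fden k t = 0 ->
  exists2 j : nat, (1 <= j <= k.-1)%N & t = gamma R k j.
Proof.
move=> k_gt0 tB; have k_ge1 : 1 <= k%:R :> R by rewrite ler1n.
have M_gt0 : 0 < 2 * k%:R - 1 :> R by lra.
have -> : t = 2 * (t / 2) by field.
rewrite Fden_half => /eqP; rewrite !mulf_eq0 pnatr_eq0 /=.
have /gt_eqF -> : 0 < cos (t / 2) by apply: cos_gt0_pihalf; have := pi_gt0 R; lra.
rewrite orbF => /eqP/sin_eq0_pi[|j j_gt0 Ej]; first by rewrite mulr_gt0 //; lra.
have Et : t / 2 = pi * j%:R / (2 * k%:R - 1).
  by rewrite -Ej [RHS]mulrC mulKf ?lt0r_neq0.
exists j; last by rewrite gammaE -Et.
rewrite j_gt0 /= leqNgt prednK //; apply/negP => ltkj.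
have lekj : k%:R <= j%:R :> R by rewrite ler_nat.
(* This is [t / 2 < pi / 2] multiplied by [2k - 1]; it forces [j < k]. *)
have : pi * j%:R < pi * (k%:R - 2^-1) :> R.
  rewrite -Ej; have -> : pi * (k%:R - 2^-1) = (2 * k%:R - 1) * (pi / 2) :> R by field.
  by rewrite ltr_pM2l //; lra.
by rewrite ltr_pM2l ?pi_gt0 //; lra.
Qed.

(* Just to the right of [gamma j], both [sin (k x)] and [Fden k x] have the sign
   [(-1)^j], hence [F k] tends to [+oo] there. *)
Lemma gamma_vertical_asymptote (R : realType) (k j : nat) :
  (1 <= j <= k.-1)%N -> vertical_asymptote (@F R k) (gamma R k j).
Proof.
move=> /andP[j_gt0 lejk]; apply: Or43.
have k_gt1 : (1 < k)%N by lia.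
have k_ge2 : 2 <= k%:R :> R by rewrite ler_nat.
have M_gt0 : 0 < 2 * k%:R - 1 :> R by lra.
have p_gt0 := pi_gt0 R.
set g := gamma R k j.
have gB : 0 < g < pi.
  rewrite /g gammaE !mulr_gt0 ?invr_gt0 ?ltr0n //=.
  apply: le_lt_trans (gamma_pred_lt_pi R k_gt1).
  by rewrite -gammaE leNgt ltr_gamma; lia.
have MgE y : (2 * k%:R - 1) * (g / 2 + y) = (2 * k%:R - 1) * y + pi * j%:R.
  by rewrite /g gammaE; field; rewrite lt0r_neq0.
have Fg : Fden k g = 0.
  have -> : g = 2 * (g / 2 + 0) by field.
  by rewrite Fden_half MgE sin_natpi mulr0 sin0; ring.
have sg : 0 < (-1) ^+ j * sin (k%:R * g).
  (* Since [(2k - 1) g / 2 = pi j], the angle [k g] is [g / 2] shifted by [pi j]. *)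
  have -> : k%:R * g = pi * j%:R / (2 * k%:R - 1) + pi * j%:R.
    by rewrite /g gammaE; field; rewrite lt0r_neq0.
  rewrite sin_natpi mulrA -exprD addnn -signr_odd odd_double mul1r.
  by apply: sin_gt0_pi; have := gB; rewrite /g gammaE; lra.
have near_sin : \forall x \near g^'+, 0 < (-1) ^+ j * sin (k%:R * x).
  have : (-1) ^+ j * sin (k%:R * x) @[x --> g^'+] --> (-1) ^+ j * sin (k%:R * g).
    by apply: cvgM; [exact: cvg_cst|apply: cvg_at_right_filter; exact: sin_mul_continuous].
  by move/cvgr_gt; apply.
have near_den : \forall x \near g^'+, 0 < (-1) ^+ j * Fden k x.
  near=> x.
  have gx : g < x by near: x; exact: nbhs_right_gt.
  have xpi : x < pi by near: x; apply: nbhs_right_lt; case/andP: gB.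
  (* This radius keeps [(2k - 1) (x - g) / 2] below [pi / 2], so the sine factor of [Fden] does not
     reach its next zero. *)
  have xg : x < g + pi / (2 * k%:R - 1).
    by near: x; apply: nbhs_right_lt; rewrite ltrDl divr_gt0.
  have -> : x = 2 * (g / 2 + (x - g) / 2) by field.
  rewrite Fden_half MgE sin_natpi mulrA mulrCA !mulrA -[2 * _ * _]mulrA -exprD.
  rewrite addnn -signr_odd odd_double mulr1 !mulr_gt0 //.
    have xgM : (2 * k%:R - 1) * (x - g) < pi.
      by rewrite mulrC -ltr_pdivlMr // ltrBlDl.
    apply: sin_gt0_pi; apply/andP; split; last lra.
    by rewrite divr_gt0 // mulr_gt0 // subr_gt0.
  apply: cos_gt0_pihalf; lra.
have near_F : \forall x \near g^'+, F k x = sin (k%:R * x) / Fden k x.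
  by apply: cvg_within; exact: near_FE.
(* Divergence to [+oo] is reduced to positivity of [F] and convergence of its inverse to 0. *)
apply/gtr0_cvgV0.
  near=> x; have -> : F k x = sin (k%:R * x) / Fden k x by near: x.
  have sx : 0 < (-1) ^+ j * sin (k%:R * x) by near: x.
  have dx : 0 < (-1) ^+ j * Fden k x by near: x.
  by have := divr_gt0 sx dx; rewrite -mulf_div divff ?mul1r // signr_eq0.
have nV : {near g^'+, (fun x : R => Fden k x / sin (k%:R * x)) =1 (fun x => (F k x)^-1)}.
  by apply: filterS near_F => x Fx; rewrite /= Fx invf_div.
apply: cvg_trans (near_eq_cvg nV) _; apply: cvg_at_right_filter.
rewrite -[X in _ --> X](mul0r (sin (k%:R * g))^-1) -Fg.
apply: cvgM; first exact: Fden_continuous.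
apply: cvgV; last exact: sin_mul_continuous.
by apply: contraTneq sg => ->; rewrite mulr0 ltxx.
Unshelve. all: by end_near. Qed.

(** * Counting *)

Lemma increasing_enum_card (R : realType) (m : nat) (x : nat -> R) (A : set R) :
  increasing_enum m x A -> (A #= `I_m)%card.
Proof.
move=> [x_incr ->].
have -> : [set x j | j in [set j : nat | (1 <= j <= m)%N]] = (x \o S) @` `I_m.
  apply/seteqP; split=> [_ [[|j] //= jm <-]|_ [j /= jm <-]]; first by exists j.
  by exists j.+1.
apply: inj_card_eq => i j; rewrite !inE /= => im jm E.
case: (ltngtP i j) => // ltij.
  by have := x_incr i.+1 j.+1 isT ltij jm; rewrite E ltxx.
by have := x_incr j.+1 i.+1 isT ltij im; rewrite E ltxx.
Qed.

Lemma increasing_enum_le (R : realType) (m : nat) (x y : nat -> R) (A : set R)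
    (j : nat) :
  increasing_enum m x A -> increasing_enum m y A ->
  (forall i, (1 <= i < j)%N -> x i = y i) -> (1 <= j <= m)%N -> y j <= x j.
Proof.
move=> [x_incr Ax] [y_incr Ay] xy jm.
have : A (x j) by rewrite Ax; exists j.
rewrite Ay => -[i /= im yi]; rewrite -yi; case: (ltngtP i j) => [ltij|ltji|-> //].
- suff : x i < x j by rewrite -yi xy ?ltxx; lia.
  by apply: x_incr; lia.
- by apply/ltW/y_incr; lia.
Qed.

(** By strong induction, the [j]-th value is the least element of [A] not yet listed. This carries
    what is known of constructed points over to an arbitrary enumeration [theta]. *)
Lemma increasing_enum_unique (R : realType) (m : nat) (x y : nat -> R)
    (A : set R) :
  increasing_enum m x A -> increasing_enum m y A ->
  forall j, (1 <= j <= m)%N -> x j = y j.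
Proof.
move=> xA yA; elim/ltn_ind => j IH jm.
have xy i : (1 <= i < j)%N -> x i = y i by move=> ij; apply: IH; lia.
apply/le_anti/andP; split; first by apply: increasing_enum_le yA xA _ jm => i /xy.
exact: increasing_enum_le xA yA xy jm.
Qed.

Lemma increasing_enum_image (R : realType) (m : nat) (x : nat -> R) (A : set R)
    (g : R -> R) :
  (forall t u, A t -> A u -> t < u -> g t < g u) -> increasing_enum m x A ->
  increasing_enum m (g \o x) (g @` A).
Proof.
move=> g_incr [x_incr Ax]; split=> [i j i1 ij jm|]; last first.
  by rewrite Ax image_comp.
by apply: g_incr; [rewrite Ax; exists i|rewrite Ax; exists j|exact: x_incr] => //=; lia.
Qed.

(** Meant for [f2], which reverses the order: with [m = k - 1] the reversed index [m + 1 - j] is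
    [k - j]. *)
Lemma increasing_enum_antiimage (R : realType) (m : nat) (x : nat -> R)
    (A : set R) (g : R -> R) :
  (forall t u, A t -> A u -> t < u -> g u < g t) -> increasing_enum m x A ->
  increasing_enum m (fun j => g (x (m.+1 - j)%N)) (g @` A).
Proof.
move=> g_decr [x_incr Ax]; split=> [i j i1 ij jm|].
  apply: g_decr; last (by apply: x_incr; lia); rewrite Ax.
    by exists (m.+1 - j)%N => //=; lia.
  by exists (m.+1 - i)%N => //=; lia.
rewrite Ax; apply/seteqP; split=> [_ [_ [j /= jm <-] <-]|_ [j /= jm <-]].
  exists (m.+1 - j)%N; first by rewrite /=; lia.
  by congr (g (x _)); lia.
by exists (x (m.+1 - j)%N) => //; exists (m.+1 - j)%N => //=; lia.
Qed.

(** Eigenvalues are roots of the characteristic polynomial, which has degree [n]. *)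
Lemma size_eigenvalues (R : fieldType) (n : nat) (A : 'M[R]_n) (s : seq R) :
  uniq s -> all (eigenvalue A) s -> (size s <= n)%N.
Proof.
move=> us As; rewrite -ltnS -(size_char_poly A).
apply: max_poly_roots => //; first exact/monic_neq0/char_poly_monic.
by apply: sub_all As => x; rewrite eigenvalue_root_char.
Qed.

Lemma intersection_eigenvalue (R : realType) (k : nat) (T : finType) (e : rel T)
    (f : R -> R) (t : R) :
  (1 < k)%N ->
  (forall u v, e u v = (u != v) && (2 * k <= deg e u + deg e v)%N) ->
  (forall u, (0 < deg e u < 2 * k)%N) ->
  (forall d, (0 < d < 2 * k)%N ->
     #|[pred w | deg e w == d]| = (1 + (d == k))%N) ->
  2 * (cos t + 1) * (f t * (f t + 1)) = 1 ->
  intersections k f t -> eigenvalue (adjmx R e) (f t).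
Proof.
move=> k_gt1 adj degB mult quad [tB Ft]; rewrite FE // => fE.
apply: (@eigenvalue_recurrence _ _ _ k
          (fun i => (-1) ^+ i * sin (i%:R * t)) (cos t));
  rewrite ?mul0r ?sin0 ?mulr0 //.
- by rewrite mul1r mulN1r oppr_eq0 lt0r_neq0 // sin_gt0_pi.
- move=> i; rewrite -!natr1 !exprS.
  have -> : (i%:R + 1 + 1) * t = (i%:R + 1) * t + t by ring.
  have -> : i%:R * t = (i%:R + 1) * t - t by ring.
  by rewrite sinD sinB; ring.
(* The alternating sign makes [p k - p k.-1] equal to [(-1)^k] times [Fden k t], so the condition at
   [k] is [F k t = f t] with the denominator cleared. *)
- have : f t * Fden k t = sin (k%:R * t) by rewrite -fE divfK.
  rewrite /Fden; case: k {adj degB mult Ft fE} k_gt1 => // k _ /=.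
  rewrite -natr1 addrK exprS => E.
  by rewrite -[in RHS]E; ring.
Qed.

(** The values [x j] are positive and the [y j] lie below [-1], so with [-1] they make
    [k + (k - 1) + 1 = n] distinct eigenvalues; a further [z] would be one too many. *)
Lemma spectrum_cover (R : realType) (k n : nat) (A : 'M[R]_n) (x y : nat -> R)
    (z : R) :
  (0 < k)%N -> n = (2 * k)%N -> eigenvalue A (-1) ->
  {in iota 1 k &, injective x} -> {in iota 1 k.-1 &, injective y} ->
  (forall j, j \in iota 1 k -> eigenvalue A (x j) /\ 0 < x j) ->
  (forall j, j \in iota 1 k.-1 -> eigenvalue A (y j) /\ y j < -1) ->
  eigenvalue A z ->
  [\/ z = -1, exists2 j, j \in iota 1 k & z = x j |
      exists2 j, j \in iota 1 k.-1 & z = y j].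
Proof.
move=> k_gt0 nE eN1 x_inj y_inj xA yA zA.
pose s := -1 :: [seq x j | j <- iota 1 k] ++ [seq y j | j <- iota 1 k.-1].
suff : z \in s.
  rewrite inE mem_cat => /or3P[/eqP|/mapP[j jk ->]|/mapP[j jk ->]].
  - by constructor 1.
  - by constructor 2; exists j.
  - by constructor 3; exists j.
apply: contraT => zs.
suff : (size (z :: s) <= n)%N by rewrite /= size_cat !size_map !size_iota nE; lia.
apply: (size_eigenvalues (A := A)); last first.
  rewrite /= zA eN1 /= all_cat; apply/andP; split.
    by apply/allP => _ /mapP[j /xA[? _] ->].
  by apply/allP => _ /mapP[j /yA[? _] ->].
rewrite cons_uniq zs cons_uniq cat_uniq !map_inj_in_uniq // !iota_uniq andbT /=.
apply/andP; split.
  rewrite mem_cat; apply/norP; split; apply/mapP => -[j].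
    by move=> /xA[_ xj] E; rewrite -E oppr_gt0 ltr10 in xj.
  by move=> /yA[_ yj] E; rewrite -E ltxx in yj.
apply/hasPn => _ /mapP[j /yA[_ yj] ->]; apply/mapP => -[i /xA[_ xi] E].
by rewrite E in yj; have := lt_trans xi yj; rewrite oppr_gt0 ltr10.
Qed.

Lemma increasing_enum_of_gamma (R : realType) (k m : nat) (x : nat -> R)
    (A : set R) :
  (0 < k)%N ->
  (forall j, (1 <= j <= m)%N -> A (x j) /\ gamma R k j.-1 < x j < gamma R k j) ->
  (forall t, A t -> exists2 j, (1 <= j <= m)%N & t = x j) ->
  increasing_enum m x A.
Proof.
move=> k_gt0 xA Ax; split=> [i j i1 ij jm|].
  have [|_ /andP[_ xi]] := xA i; first lia.
  have [|_ /andP[xj _]] := xA j; first lia.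
  apply: lt_trans xi (le_lt_trans _ xj).
  by rewrite leNgt ltr_gamma //; lia.
apply/seteqP; split=> [t /Ax[j jm ->]|_ [j /= /xA[xj _] <-]] //.
by exists j.
Qed.

Theorem theorem5p2 (R : realType) (k : nat) (T : finType) (e : rel T)
    (k_ge2 : (2 <= k)%N) (cardT : #|T| = (2 * k)%N)
    (e_sym : symmetric e) (e_irr : irreflexive e)
    (e_conn : connected_graph e) (e_anti : antiregular e) :
  [/\ (forall t : R, 0 < t < pi ->
         (vertical_asymptote (F k) t <->
          exists2 j : nat, (1 <= j <= k.-1)%N & t = gamma R k j)),
      (intersections k (@f1 R) #= `I_k)%card /\
      (forall theta : nat -> R,
         increasing_enum k theta (intersections k (@f1 R)) ->
         increasing_enum k (fun j => f1 (theta j))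
           [set x : R | eigenvalue (adjmx R e) x /\ 0 < x] /\
         (forall j : nat, (1 <= j <= k.-1)%N ->
            f1 (gamma R k j.-1) < f1 (theta j) < f1 (gamma R k j))) &
      (intersections k (@f2 R) #= `I_k.-1)%card /\
      (forall theta : nat -> R,
         increasing_enum k.-1 theta (intersections k (@f2 R)) ->
         [/\ increasing_enum k.-1 (fun j => f2 (theta (k - j)%N))
               [set x : R | [/\ eigenvalue (adjmx R e) x, x < 0 & x <> -1]],
             f2 (theta 1%N) < -1 &
             forall j : nat, (1 <= j <= k.-1)%N ->
               f2 (gamma R k j) < f2 (theta j) < f2 (gamma R k j.-1)])].
Proof.
have k_gt0 : (0 < k)%N by lia.
have [adj degB mult] := antiregular_structure k_gt0 cardT e_sym e_irr e_conn e_anti.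
have tB (f : R -> R) (t : R) : intersections k f t -> 0 <= t < pi.
  by case=> /andP[t0 ->] _ _; rewrite ltW.
have eigN1 := eigenvalue_twins R k_gt0 adj mult.
have eig1 t : intersections k (@f1 R) t -> eigenvalue (adjmx R e) (f1 t).
  move=> tI; apply: (intersection_eigenvalue k_ge2 adj degB mult _ tI).
  exact/f1_quadratic/(tB _ _ tI).
have eig2 t : intersections k (@f2 R) t -> eigenvalue (adjmx R e) (f2 t).
  move=> tI; apply: (intersection_eigenvalue k_ge2 adj degB mult _ tI).
  exact/f2_quadratic/(tB _ _ tI).
have incr1 t u : intersections k (@f1 R) t -> intersections k (@f1 R) u ->
    t < u -> f1 t < f1 u.
  by move=> /tB/andP[t0 _] /tB/andP[_ u1] tu; exact: ltr_f1.
have decr2 t u : intersections k (@f2 R) t -> intersections k (@f2 R) u ->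
    t < u -> f2 u < f2 t.
  by move=> /tB/andP[t0 _] /tB/andP[_ u1] tu; exact: ltr_f2.
have inj1 t u : intersections k (@f1 R) t -> intersections k (@f1 R) u ->
    f1 t = f1 u -> t = u.
  move=> tI uI E; case: (ltgtP t u) => // [/(incr1 _ _ tI uI)|/(incr1 _ _ uI tI)];
  by rewrite E ltxx.
have inj2 t u : intersections k (@f2 R) t -> intersections k (@f2 R) u ->
    f2 t = f2 u -> t = u.
  move=> tI uI E; case: (ltgtP t u) => // [/(decr2 _ _ tI uI)|/(decr2 _ _ uI tI)];
  by rewrite E ltxx.
(* The range of [j] is put under the existential so that the choice is a total function; 0 is a
   default outside the range. *)
have /choice[t1 t1P] : forall j, exists t, (1 <= j <= k)%N ->
    intersections k (@f1 R) t /\ gamma R k j.-1 < t < gamma R k j.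
  move=> j; have [jk|njk] := boolP (1 <= j <= k)%N; last by exists 0.
  by have [t] := f1_intersection_exists R k_ge2 jk; exists t.
have /choice[t2 t2P] : forall j, exists t, (1 <= j <= k.-1)%N ->
    intersections k (@f2 R) t /\ gamma R k j.-1 < t < gamma R k j.
  move=> j; have [jk|njk] := boolP (1 <= j <= k.-1)%N; last by exists 0.
  have jk' : (0 < j < k)%N by lia.
  by have [t] := f2_intersection_exists R k_ge2 jk'; exists t.
have iotaP j m : j \in iota 1 m = (1 <= j <= m)%N by rewrite mem_iota add1n ltnS.
have gamma_inj (m : nat) (x : nat -> R) (A : set R) :
    (forall j, (1 <= j <= m)%N -> A (x j) /\ gamma R k j.-1 < x j < gamma R k j) ->
    {in iota 1 m &, injective x}.
  move=> xP i j; rewrite !iotaP => im jm E.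
  have [_ /andP[il ir]] := xP i im; have [_ /andP[jl jr]] := xP j jm.
  have : gamma R k i.-1 < gamma R k j by rewrite (lt_trans il) // E.
  have : gamma R k j.-1 < gamma R k i by rewrite (lt_trans jl) // -E.
  by rewrite !ltr_gamma //; lia.
have cover z : eigenvalue (adjmx R e) z ->
    [\/ z = -1, exists2 j, j \in iota 1 k & z = f1 (t1 j) |
        exists2 j, j \in iota 1 k.-1 & z = f2 (t2 j)].
  apply: (spectrum_cover (x := fun j => f1 (t1 j)) (y := fun j => f2 (t2 j))
            k_gt0 cardT eigN1).
  - move=> i j ik jk E; apply: (gamma_inj _ _ _ t1P) => //.
    by move: ik jk E; rewrite !iotaP => /t1P[iI _] /t1P[jI _]; apply: inj1.
  - move=> i j ik jk E; apply: (gamma_inj _ _ _ t2P) => //.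
    by move: ik jk E; rewrite !iotaP => /t2P[iI _] /t2P[jI _]; apply: inj2.
  - move=> j; rewrite iotaP => /t1P[jI _]; split; first exact: eig1.
    exact/f1_gt0/(tB _ _ jI).
  - move=> j; rewrite iotaP => /t2P[jI _]; split; first exact: eig2.
    exact/f2_ltN1/(tB _ _ jI).
have pos1 t : intersections k (@f1 R) t -> 0 < f1 t by move/tB/f1_gt0.
have neg2 t : intersections k (@f2 R) t -> f2 t < -1 by move/tB/f2_ltN1.
have pos_eig z : eigenvalue (adjmx R e) z -> 0 < z ->
    exists2 j, (1 <= j <= k)%N & z = f1 (t1 j).
  move=> /cover[->|[j]|[j]]; rewrite ?iotaP; first by rewrite oppr_gt0 ltr10.
    by move=> jk -> _; exists j.
  by move=> /t2P[/neg2 lt1 _] ->; rewrite ltNge ltW // (lt_trans lt1) // oppr_lt0.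
have neg_eig z : eigenvalue (adjmx R e) z -> z < 0 -> z <> -1 ->
    exists2 j, (1 <= j <= k.-1)%N & z = f2 (t2 j).
  move=> /cover[->//|[j]|[j]]; rewrite iotaP.
    by move=> /t1P[/pos1 gt0 _] ->; rewrite ltNge ltW.
  by move=> jk -> _ _; exists j.
(* Any intersection [t] gives a positive eigenvalue [f1 t], which is some [f1 (t1 j)] by the count;
   injectivity of [f1] then gives [t = t1 j]. *)
have enum1 : increasing_enum k t1 (intersections k (@f1 R)).
  apply: (increasing_enum_of_gamma k_gt0 t1P) => // t tI.
  have [j jk E] := pos_eig _ (eig1 _ tI) (pos1 _ tI).
  by exists j => //; apply: inj1 => //; case: (t1P j jk).
have enum2 : increasing_enum k.-1 t2 (intersections k (@f2 R)).
  apply: (increasing_enum_of_gamma k_gt0 t2P) => // t tI.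
  have t_lt := neg2 _ tI.
  have [||j jk E] := neg_eig _ (eig2 _ tI).
  - by rewrite (lt_trans t_lt) // oppr_lt0.
  - by move=> E; rewrite E ltxx in t_lt.
  by exists j => //; apply: inj2 => //; case: (t2P j jk).
have posE : [set x | eigenvalue (adjmx R e) x /\ 0 < x] = @f1 R @` intersections k (@f1 R).
  apply/seteqP; split=> [z [ez /(pos_eig _ ez)[j /t1P[jI _] ->]]|_ [t tI <-]].
    by exists (t1 j).
  by split; [exact: eig1|exact: pos1].
have negE : [set x | [/\ eigenvalue (adjmx R e) x, x < 0 & x <> -1]] =
    @f2 R @` intersections k (@f2 R).
  apply/seteqP; split=> [z [ez z0 /(neg_eig _ ez z0)[j /t2P[jI _] ->]]|_ [t tI <-]].
    by exists (t2 j).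
  have t_lt := neg2 _ tI; split; first exact: eig2.
    by rewrite (lt_trans t_lt) // oppr_lt0.
  by move=> E; rewrite E ltxx in t_lt.
have gamma_ge0 j : 0 <= gamma R k j.
  rewrite leNgt; apply/negP; have -> : 0 = gamma R k 0 by rewrite gammaE mulr0 mul0r mulr0.
  by rewrite ltr_gamma.
have gamma_lt_pi j : (j <= k.-1)%N -> gamma R k j < pi.
  move=> jk; apply: le_lt_trans (gamma_pred_lt_pi R k_ge2).
  by rewrite leNgt ltr_gamma; lia.
split.
- move=> t tpi; split; first by move/(vertical_asymptote_Fden0 tpi)/(Fden0_gamma k_gt0 tpi).
  by move=> [j jk ->]; exact: gamma_vertical_asymptote.
- split; first exact: increasing_enum_card enum1.
  move=> theta thetaP; split; first by rewrite posE; exact: increasing_enum_image.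
  move=> j jk; have jk' : (1 <= j <= k)%N by lia.
  rewrite (increasing_enum_unique thetaP enum1 jk').
  have [_ /andP[jl jr]] := t1P j jk'.
  have gj : gamma R k j < pi by apply: gamma_lt_pi; lia.
  have g0 := gamma_ge0 j.-1.
  rewrite !ltr_f1 //; [exact: le_trans g0 (ltW jl)|exact: lt_trans jr gj].
- split; first exact: increasing_enum_card enum2.
  move=> theta thetaP; have theta_t2 := increasing_enum_unique thetaP enum2.
  have k1 : (1 <= 1 <= k.-1)%N by lia.
  split.
  + by rewrite negE; have := increasing_enum_antiimage decr2 thetaP; rewrite prednK.
  + by rewrite theta_t2 //; apply: neg2; case: (t2P 1%N k1).
  + move=> j jk; rewrite theta_t2 //; have [_ /andP[jl jr]] := t2P j jk.
    have gj : gamma R k j < pi by apply: gamma_lt_pi; lia.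
    have g0 := gamma_ge0 j.-1.
    rewrite !ltr_f2 //; [exact: lt_trans jr gj|exact: le_trans g0 (ltW jl)].
Qed.
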